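(* Morphisms of topped PCMs are closed under the following constructions. (a) If $\beta:A\to B$ and $\alpha:B\to C$ are morphisms, then $\alpha\circ\beta:A\to C$, $(\alpha\circ\beta)(x)=\alpha(\beta(x))$, is a morphism with separating relation $x\perp_{\alpha\circ\beta}y :\Leftrightarrow x\perp_\beta y\wedge \beta(x)\perp_\alpha\beta(y)$. (b) If $\alpha:A\to B$ and $\beta:A\to C$ are morphisms, then $\alpha\otimes\beta:A\to B\times C$, $(\alpha\otimes\beta)(x)=(\alpha(x),\beta(x))$, is a morphism with separating relation $x\perp_{\alpha\otimes\beta}y:\Leftrightarrow x\perp_\alpha y\wedge x\perp_\beta y$. (c) If $\alpha:A_1\to B_1$ and $\beta:A_2\to B_2$ are morphisms, then $\alpha\times\beta:A_1\times A_2\to B_1\times B_2$, $(\alpha\times\beta)(x_1,x_2)=(\alpha(x_1),\beta(x_2))$, is a morphism with separating relation $(x_1,x_2)\perp_{\alpha\times\beta}(y_1,y_2):\Leftrightarrow x_1\perp_\alpha y_1\wedge x_2\perp_\beta y_2$.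
   Context: A topped PCM is a tuple $(A,\bullet,\mathbb{1},\top,D)$ where $\bullet$ is a total commutative associative binary operation on $A$ with unit $\mathbb{1}$, $\top\in A$, and $D\subseteq A$ (the defined elements) satisfy: $\top\notin D$; $\mathbb{1}\in D$; if $x\bullet y\in D$ then $x,y\in D$; $x\bullet\top=\top\bullet x=\top$. Write $x\perp y$ for $x\bullet y\in D$. The product $A\times B$ of topped PCMs is the topped PCM with $\bullet$, $\mathbb{1}$, $\top$ defined componentwise and $D=D_A\times D_B$. A relation $R$ on $A$ is a separating relation if: (1) $x\,R\,y$ implies $x\,R\,\mathbb{1}$; (2) $x\,R\,y$ implies $x\perp y$; (3) $\mathbb{1}\,R\,\mathbb{1}$; (4) $x\,R\,y$ iff $y\,R\,x$; (5) $x\,R\,y$ and $(x\bullet y)\,R\,z$ imply $x\,R\,(y\bullet z)$ and $y\,R\,z$. A morphism $\phi:A\to B$ of topped PCMs with separating relation $\perp_\phi$ on $A$ is a function such that $\phi(\mathbb{1}_A)=\mathbb{1}_B$, $\phi(\top_A)=\top_B$, and $x\perp_\phi y$ implies $\phi(x)\perp\phi(y)$ and $\phi(x\bullet y)=\phi(x)\bullet\phi(y)$. (So asserting that something is a morphism with a given relation includes that the relation is a separating relation.) *)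

(* Defs.v *)
From HB Require Import structures.
From mathcomp Require Import all_boot.

Set Implicit Arguments.
Unset Strict Implicit.
Unset Printing Implicit Defensive.

Declare Scope tpcm_scope.
Delimit Scope tpcm_scope with tpcm.
Local Open Scope tpcm_scope.

HB.mixin Record isToppedPCM (A : Type) := {
  pcm_op : A -> A -> A;
  pcm_unit : A;
  pcm_top : A;
  pcm_def : A -> Prop;
  pcm_opC : commutative pcm_op;
  pcm_opA : associative pcm_op;
  pcm_op1x : left_id pcm_unit pcm_op;
  pcm_def_top : ~ pcm_def pcm_top;
  pcm_def_unit : pcm_def pcm_unit;
  pcm_def_op : forall x y, pcm_def (pcm_op x y) -> pcm_def x /\ pcm_def y;
  pcm_opxT : right_zero pcm_top pcm_op;
  pcm_opTx : left_zero pcm_top pcm_op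
}.

#[short(type="toppedPCM")]
HB.structure Definition ToppedPCM := { A of isToppedPCM A }.

Infix "•" := pcm_op (at level 40, left associativity) : tpcm_scope.

Definition orth (A : toppedPCM) (x y : A) : Prop := pcm_def (x • y).

Section Product.
Variables A B : toppedPCM.

Definition prod_op (p q : A * B) : A * B := (p.1 • q.1, p.2 • q.2).
Definition prod_unit : A * B := (pcm_unit, pcm_unit).
Definition prod_top : A * B := (pcm_top, pcm_top).
Definition prod_def (p : A * B) : Prop := pcm_def p.1 /\ pcm_def p.2.

Fact prod_opC : commutative prod_op.
Proof. by move=> p q; rewrite /prod_op pcm_opC [p.2 • _]pcm_opC. Qed.

Fact prod_opA : associative prod_op.
Proof. by move=> p q r; rewrite /prod_op /= !pcm_opA. Qed.

Fact prod_op1x : left_id prod_unit prod_op.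
Proof. by case=> a b; rewrite /prod_op /= !pcm_op1x. Qed.

Fact prod_def_top : ~ prod_def prod_top.
Proof. by case=> /pcm_def_top. Qed.

Fact prod_def_unit : prod_def prod_unit.
Proof. by split; apply: pcm_def_unit. Qed.

Fact prod_def_op p q : prod_def (prod_op p q) -> prod_def p /\ prod_def q.
Proof. by case=> /pcm_def_op[? ?] /pcm_def_op[? ?]. Qed.

Fact prod_opxT : right_zero prod_top prod_op.
Proof. by move=> p; rewrite /prod_op /= !pcm_opxT. Qed.

Fact prod_opTx : left_zero prod_top prod_op.
Proof. by move=> p; rewrite /prod_op /= !pcm_opTx. Qed.

HB.instance Definition _ := isToppedPCM.Build (A * B)%type
  prod_opC prod_opA prod_op1x prod_def_top prod_def_unit prod_def_op
  prod_opxT prod_opTx.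
End Product.

Record separating (A : toppedPCM) (R : A -> A -> Prop) : Prop := Separating {
  sep_unitr : forall x y, R x y -> R x pcm_unit;
  sep_orth : forall x y, R x y -> orth x y;
  sep_unit : R pcm_unit pcm_unit;
  sep_sym : forall x y, R x y <-> R y x;
  sep_assoc : forall x y z, R x y -> R (x • y) z -> R x (y • z) /\ R y z
}.

(* The separating relation is data of the morphism, not determined by [f]: a
   morphism is a pair [(f, R)]. *)
Record morphism (A B : toppedPCM) (f : A -> B) (R : A -> A -> Prop) : Prop :=
  Morphism {
    morph_sep : separating R;
    morph_unit : f pcm_unit = pcm_unit;
    morph_top : f pcm_top = pcm_top;
    morph_op : forall x y, R x y -> orth (f x) (f y) /\ f (x • y) = f x • f y
  }.

Definition comp_sep (A B : Type) (b : A -> B) (Ra : B -> B -> Prop)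
    (Rb : A -> A -> Prop) : A -> A -> Prop :=
  fun x y => Rb x y /\ Ra (b x) (b y).

Definition tensor_fun (A B C : Type) (a : A -> B) (b : A -> C) : A -> B * C :=
  fun x => (a x, b x).

Definition tensor_sep (A : Type) (Ra Rb : A -> A -> Prop) : A -> A -> Prop :=
  fun x y => Ra x y /\ Rb x y.

Definition prod_fun (A1 A2 B1 B2 : Type) (a : A1 -> B1) (b : A2 -> B2) :
    A1 * A2 -> B1 * B2 :=
  fun x => (a x.1, b x.2).

Definition prod_sep (A1 A2 : Type) (Ra : A1 -> A1 -> Prop)
    (Rb : A2 -> A2 -> Prop) : A1 * A2 -> A1 * A2 -> Prop :=
  fun x y => Ra x.1 y.1 /\ Rb x.2 y.2.

(* Main.v *)
Require Import Defs.
From mathcomp Require Import all_boot.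

Local Open Scope tpcm_scope.

(** Each relation collects exactly the conditions under which the combined map splits a product, so
    the morphism laws follow by chaining or pairing those of the factors. The real content is that
    these relations are separating. For [tensor_sep] and [prod_sep] this holds conjunct by conjunct.
    For [comp_sep] it is a pullback along [beta], which is multiplicative only on [Rbeta]-related
    pairs; hence [separating_comp] takes [beta] as a morphism, but of [alpha] only that its relation
    is separating. *)

(* In the associativity axiom, [beta (x • y)] and [beta (y • z)] split because
   [Rbeta x y] is assumed and [Rbeta y z] is already derived for [Rbeta]. *)
Lemma separating_comp (A B : toppedPCM) (beta : A -> B)
    (Ralpha : B -> B -> Prop) (Rbeta : A -> A -> Prop) :
  morphism beta Rbeta -> separating Ralpha ->
  separating (comp_sep beta Ralpha Rbeta).
Proof.
move=> [sepb beta1 _ betaM] sepa; split.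
- move=> x y [/(sep_unitr sepb) Rb /(sep_unitr sepa) Ra].
  by split; rewrite ?beta1.
- by move=> x y [/(sep_orth sepb)].
- by split; rewrite ?beta1; [apply: sep_unit sepb | apply: sep_unit sepa].
- by move=> x y; split=> -[/(sep_sym sepb) Rb /(sep_sym sepa) Ra].
- move=> x y z [Rbxy Raxy] [Rbxyz Raxyz].
  have [Rbx Rbyz] := sep_assoc sepb Rbxy Rbxyz.
  rewrite (betaM _ _ Rbxy).2 in Raxyz.
  have [Rax Rayz] := sep_assoc sepa Raxy Raxyz.
  by split; split; rewrite // (betaM _ _ Rbyz).2.
Qed.

(** Every axiom is an implication between instances of the relation, hence stable under
    intersection; orthogonality is inherited from [R] alone. *)
Lemma separating_tensor (A : toppedPCM) (R S : A -> A -> Prop) :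
  separating R -> separating S -> separating (tensor_sep R S).
Proof.
move=> sepR sepS; split.
- by move=> x y [/(sep_unitr sepR) Rx /(sep_unitr sepS) Sx].
- by move=> x y [/(sep_orth sepR)].
- by split; [apply: sep_unit sepR | apply: sep_unit sepS].
- by move=> x y; split=> -[/(sep_sym sepR) Rxy /(sep_sym sepS) Sxy].
- move=> x y z [Rxy Sxy] [Rxyz Sxyz].
  have [Rx Ryz] := sep_assoc sepR Rxy Rxyz.
  by have [Sx Syz] := sep_assoc sepS Sxy Sxyz.
Qed.

(** The axioms hold coordinatewise since unit and operation of [A * B] are componentwise.
    Orthogonality now needs both factors, definedness being asked of each coordinate. *)
Lemma separating_prod (A B : toppedPCM) (R : A -> A -> Prop)
    (S : B -> B -> Prop) :
  separating R -> separating S -> separating (prod_sep R S).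
Proof.
move=> sepR sepS; split.
- by move=> x y [/(sep_unitr sepR) Rx /(sep_unitr sepS) Sx].
- by move=> x y [/(sep_orth sepR) Rxy /(sep_orth sepS) Sxy].
- by split; [apply: sep_unit sepR | apply: sep_unit sepS].
- by move=> x y; split=> -[/(sep_sym sepR) Rxy /(sep_sym sepS) Sxy].
- move=> x y z [Rxy Sxy] [Rxyz Sxyz].
  have [Rx Ryz] := sep_assoc sepR Rxy Rxyz.
  by have [Sx Syz] := sep_assoc sepS Sxy Sxyz.
Qed.

Lemma morphism_comp (A B C : toppedPCM) (alpha : B -> C) (beta : A -> B)
    (Ralpha : B -> B -> Prop) (Rbeta : A -> A -> Prop) :
  morphism beta Rbeta -> morphism alpha Ralpha ->
  morphism (alpha \o beta) (comp_sep beta Ralpha Rbeta).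
Proof.
move=> morb [sepa alpha1 alphaT alphaM].
have [_ beta1 betaT betaM] := morb; split.
- exact: separating_comp.
- by rewrite /= beta1.
- by rewrite /= betaT.
(* [Rb] lets [beta] split the product; [Ra] then lets [alpha] split the product of the images. *)
- by move=> x y [Rb Ra]; rewrite /= (betaM _ _ Rb).2; apply: alphaM.
Qed.

Lemma morphism_tensor (A B C : toppedPCM) (alpha : A -> B) (beta : A -> C)
    (Ralpha Rbeta : A -> A -> Prop) :
  morphism alpha Ralpha -> morphism beta Rbeta ->
  morphism (tensor_fun alpha beta) (tensor_sep Ralpha Rbeta).
Proof.
move=> [sepa alpha1 alphaT alphaM] [sepb beta1 betaT betaM]; split.
- exact: separating_tensor.
- by rewrite /tensor_fun alpha1 beta1.
- by rewrite /tensor_fun alphaT betaT.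
- move=> x y [/alphaM[oa ea] /betaM[ob eb]].
  (* Orthogonality in the product unfolds to the pair [oa], [ob]. *)
  by rewrite /tensor_fun ea eb.
Qed.

Lemma morphism_prod (A1 A2 B1 B2 : toppedPCM) (alpha : A1 -> B1)
    (beta : A2 -> B2) (Ralpha : A1 -> A1 -> Prop) (Rbeta : A2 -> A2 -> Prop) :
  morphism alpha Ralpha -> morphism beta Rbeta ->
  morphism (prod_fun alpha beta) (prod_sep Ralpha Rbeta).
Proof.
move=> [sepa alpha1 alphaT alphaM] [sepb beta1 betaT betaM]; split.
- exact: separating_prod.
- by rewrite /prod_fun alpha1 beta1.
- by rewrite /prod_fun alphaT betaT.
- move=> x y [/alphaM[oa ea] /betaM[ob eb]].
  by rewrite /prod_fun ea eb.
Qed.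

Theorem mainTheorem2 :
  (forall (A B C : toppedPCM) (alpha : B -> C) (beta : A -> B)
     (Ralpha : B -> B -> Prop) (Rbeta : A -> A -> Prop),
     morphism beta Rbeta -> morphism alpha Ralpha ->
     morphism (alpha \o beta) (comp_sep beta Ralpha Rbeta)) /\
  (forall (A B C : toppedPCM) (alpha : A -> B) (beta : A -> C)
     (Ralpha Rbeta : A -> A -> Prop),
     morphism alpha Ralpha -> morphism beta Rbeta ->
     morphism (tensor_fun alpha beta) (tensor_sep Ralpha Rbeta)) /\
  (forall (A1 A2 B1 B2 : toppedPCM) (alpha : A1 -> B1) (beta : A2 -> B2)
     (Ralpha : A1 -> A1 -> Prop) (Rbeta : A2 -> A2 -> Prop),
     morphism alpha Ralpha -> morphism beta Rbeta ->
     morphism (prod_fun alpha beta) (prod_sep Ralpha Rbeta)).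
Proof.
split; first exact: morphism_comp.
by split; [exact: morphism_tensor | exact: morphism_prod].
Qed.
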